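(* Let $d\ge 1$, let $\mathbf{k}=(k_1,\ldots,k_d)\in\mathbb{N}^d$ (positive integers), and let $r\in\mathbb{N}$ with $r\ge d$. Then \[ \sum_{\substack{r_1+\cdots+r_d=r\\ r_i\ge 1\ (1\le i\le d)}}\zeta(k_1+1,\underbrace{1,\ldots,1}_{r_1-1},\ldots,k_d+1,\underbrace{1,\ldots,1}_{r_d-1}) =\sum_{\substack{\mathbf{k}'\succeq\mathbf{k}\\ \mathrm{dep}(\mathbf{k}')\le r}}\ \sum_{\substack{\mathrm{wt}(\mathbf{r})=r\\ \mathrm{dep}(\mathbf{r})=\mathrm{dep}(\mathbf{k}')}}(-1)^{\mathrm{dep}(\mathbf{k}')-d}\,\zeta(\mathbf{k}'+\mathbf{r}), \] where $\mathbf{k}'$ runs over indices refining $\mathbf{k}$ and $\mathbf{r}$ runs over indices (tuples of positive integers) of weight $r$ and the same depth as $\mathbf{k}'$.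
   Context: An index is a finite tuple $\mathbf{k}=(k_1,\ldots,k_d)$ of positive integers; its weight is $\mathrm{wt}(\mathbf{k})=k_1+\cdots+k_d$ and its depth is $\mathrm{dep}(\mathbf{k})=d$. For an index with $k_1\ge 2$, the multiple zeta value is $\zeta(k_1,\ldots,k_d)=\sum_{n_1>\cdots>n_d\ge 1} n_1^{-k_1}\cdots n_d^{-k_d}$. For indices $\mathbf{k}=(k_1,\ldots,k_i)$ and $\mathbf{r}=(r_1,\ldots,r_i)$ of the same depth, $\zeta(\mathbf{k}+\mathbf{r})$ means $\zeta(k_1+r_1,\ldots,k_i+r_i)$. For indices $\mathbf{k},\mathbf{k}'$, we say $\mathbf{k}'$ refines $\mathbf{k}$, written $\mathbf{k}'\succeq\mathbf{k}$, if $\mathbf{k}$ can be obtained from $\mathbf{k}'$ by adding together some groups of adjacent entries (e.g. $(1,2,3,4)\succeq(3,7)$; also $\mathbf{k}\succeq\mathbf{k}$). *)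

(* Defs.v *)
From HB Require Import structures.
From mathcomp Require Import all_boot all_order all_algebra.
From mathcomp Require Import all_classical all_reals all_analysis.

Set Implicit Arguments.
Unset Strict Implicit.
Unset Printing Implicit Defensive.

Import Order.TTheory GRing.Theory Num.Theory.

Local Open Scope classical_set_scope.
Local Open Scope ring_scope.

(* An index is a sequence of positive integers; its weight is [sumn k] and its
   depth is [size k]. *)
Definition is_index (k : seq nat) : bool := all (fun m => 0 < m)%N k.

Definition refines (k' k : seq nat) : Prop :=
  exists groups : seq (seq nat),
    [/\ all (fun g => g != [::]) groups, flatten groups = k'
      & map sumn groups = k].

Definition indices (d w : nat) : set (seq nat) :=
  [set r | [/\ is_index r, size r = d & sumn r = w]].

Definition index_add (k r : seq nat) : seq nat :=
  [seq p.1 + p.2 | p <- zip k r]%N.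

(* (k_1 + 1, 1, ..., 1, ..., k_d + 1, 1, ..., 1), where the i-th entry k_i + 1
   is followed by r_i - 1 ones. *)
Definition index_pad (k r : seq nat) : seq nat :=
  flatten [seq p.1.+1 :: nseq p.2.-1 1%N | p <- zip k r].

Definition mzv_domain (d : nat) : set (seq nat) :=
  [set n | [/\ size n = d, sorted (fun a b => b < a)%N n
             & all (fun m => 0 < m)%N n]].

(* The unordered sum of nonnegative terms is taken in [\bar R]; [fine] sends it
   to 0 when it diverges, which does not happen when the first entry of k is at
   least 2. *)
Definition mzv (R : realType) (k : seq nat) : R :=
  fine (\esum_(n in mzv_domain (size k))
          (\prod_(p <- zip n k) p.1%:R ^- p.2)%:E).

(* Main.v *)
(* Write every multiple zeta value as the sum over n of an iterated sum
   f(n) = n^-k_1 * sum_(l < n) ..., and, for 0 <= x < 1, couple two such terms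
   by the connected sum of Seki and Yamamoto
     Z(f, g) = sum_(n, m) f(n) g(m) C(n, m),
     C(n, m) = G(n - x + 1) G(m - x + 1) / (G(n + m - x + 1) G(1 - x)),
   with G the Gamma function.  Put S f(n) = sum_(l < n) f(l) and
   W f = S f / (n - x).  Telescoping gives Z(W f, g) = Z(f, g / m), and by
   symmetry Z(f / n, g) = Z(f, W g).

   At x = 0 this moves the entries of an index one by one to the other side; in
   particular it proves the duality
     zeta(index_pad k r) = zeta(index_pad (rev r) (rev k))
   as well as the convergence of all the series involved.

   For x > 0 the operator V f = x S f / (n (n - x)), which is x W f / n, is
   self-adjoint for Z, while A f = S f / n = W f - V f is moved to
   g |-> g / m - V g.  By duality, the generating function in x of the
   left-hand side is the sum of V A^(k_d - 1) ... V A^(k_1 - 1) applied to the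
   indicator of 0.  Moving all the operators to the other side, V opens a new
   entry 1 of an index k' and each A either increments its first entry or, with
   a minus sign, opens a new entry 1: this runs through the refinements k' of k,
   and every entry p of k' contributes x / (m^p (m - x)), the generating
   function of the m^-(p + r_i), r_i >= 1.  Comparing the coefficients of x^r
   gives the theorem. *)

Require Import Defs.
From HB Require Import structures.
From mathcomp Require Import all_boot all_order all_algebra.
From mathcomp Require Import all_classical all_reals all_analysis.
From mathcomp Require Import ring lra.

Set Implicit Arguments.
Unset Strict Implicit.
Unset Printing Implicit Defensive.

Import Order.TTheory GRing.Theory Num.Theory numFieldNormedType.Exports.

Local Open Scope classical_set_scope.
Local Open Scope ring_scope.

(** * Sums in the extended reals *)

Section ExtendedSums.
Context {R : realType}.
Local Open Scope ereal_scope.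

(** Comparing finite subsums gives one inequality for every scalar; the converse is the same
    inequality for the scalar c^-1, with c = 0 treated apart. *)
Lemma esumZl (T : choiceType) (I : set T) (c : R) (a : T -> \bar R) :
  (0 <= c)%R -> (forall i, I i -> 0 <= a i) ->
  \esum_(i in I) (c%:E * a i) = c%:E * \esum_(i in I) a i.
Proof.
move=> c0 a0.
have le_scale (b : T -> \bar R) (e : R) : (0 <= e)%R ->
    (forall i, I i -> 0 <= b i) ->
    \esum_(i in I) (e%:E * b i) <= e%:E * \esum_(i in I) b i.
  move=> e0 b0; apply: ge_ereal_sup => _ [X [finX XI] <-].
  have -> : \sum_(i \in X) (e%:E * b i) = e%:E * \sum_(i \in X) b i.
    rewrite !fsbig_finite//= big_seq -ge0_sume_distrr -?big_seq// => i.
    by rewrite in_fset_set// inE => /XI/b0.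
  apply: lee_wpmul2l; first by rewrite lee_fin.
  by apply: ereal_sup_ubound; exists X.
apply/eqP; rewrite eq_le le_scale//=.
have [->|cn0] := eqVneq c 0%R.
  by rewrite mul0e esum_ge0// => i _; rewrite mul0e.
have ca0 i : I i -> 0 <= c%:E * a i by move=> Ii; rewrite mule_ge0 ?lee_fin// a0.
have ci0 : (0 <= c^-1)%R by rewrite invr_ge0.
have := le_scale _ _ ci0 ca0.
under eq_esum do rewrite muleA -EFinM mulVf// mul1e.
by move=> /(lee_wpmul2l (_ : 0 <= c%:E)); rewrite lee_fin => /(_ c0);
  rewrite muleA -EFinM mulfV// mul1e.
Qed.

Lemma esum_swap (T1 T2 : choiceType) (I : set T1) (J : set T2)
    (a : T1 -> T2 -> \bar R) : (forall i j, 0 <= a i j) ->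
  \esum_(i in I) \esum_(j in J) a i j = \esum_(j in J) \esum_(i in I) a i j.
Proof.
move=> a0; rewrite !esum_esum//.
rewrite (reindex_esum (J `*` I) _ (fun p => (p.2, p.1)))//; split => //=.
- by move=> [i j] [].
- by move=> [i1 i2] [j1 j2] /= _ _ [] -> ->.
- by move=> [i1 i2] [Pi1 Qi2] /=; exists (i2, i1).
Qed.

(** The indicator makes the range of l independent of n, so that [esum_swap] can exchange the two
    sums. *)
Lemma esum_nat_lt (n : nat) (F : nat -> R) : (forall l, (0 <= F l)%R) ->
  (\sum_(l < n) F l)%R%:E = \esum_(l in [set: nat]) ((l < n)%N%:R * F l)%:E.
Proof.
move=> F0; transitivity (\esum_(l in `I_n) (F l)%:E).
  rewrite esum_fset//; last by move=> i _; rewrite lee_fin.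
  by rewrite -fsbig_ord sumEFin.
rewrite esum_mkcond; apply: eq_esum => l _.
have [ln|ln] := boolP (l < n)%N; first by rewrite mem_set// mul1r.
by rewrite memNset ?mul0r//=; exact/negP.
Qed.

(** The terms with n <= l vanish, so [n.-1] is only used for n >= 1; the sum up to n = N + l is u l
    - u (N + l). *)
Lemma esum_telescope (u : nat -> R) (l : nat) :
  (forall n, u n.+1 <= u n)%R -> u @ \oo --> 0%R ->
  \esum_(n in [set: nat]) ((l < n)%N%:R * (u n.-1 - u n))%:E = (u l)%:E.
Proof.
move=> u_decr u_cvg; rewrite -nneseries_esumT; last first.
  by case=> [|n]; rewrite lee_fin ?mul0r// mulr_ge0// subr_ge0 u_decr.
apply/cvg_lim => //; rewrite -(cvg_shiftn l.+1)/=.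
have -> : (fun N => \sum_(0 <= n < N + l.+1)
              ((l < n)%N%:R * (u n.-1 - u n))%:E)
          = (fun N => (u l - u (N + l)%N)%:E).
  apply/funext; elim=> [|N IHN].
    rewrite !add0n subrr big_nat big1// => n /andP[_].
    by rewrite ltnS ltnNge => ->; rewrite mul0r.
  rewrite addSn big_nat_recr//= IHN -EFinD addnS ltnS leq_addl mul1r/=.
  by rewrite addrA subrK addSn.
rewrite -[X in _ --> X%:E]subr0; apply: cvg_EFin; first exact: nearW.
apply: cvgB; first exact: cvg_cst.
by rewrite (cvg_shiftn l).
Qed.

End ExtendedSums.

(** * Connected sums *)

Section Kernel.
Context {R : realType}.
Variable x : R.
Hypothesis x01 : 0 <= x < 1.

(* C(n, m) in closed form: the Gamma factors cancel. *)
Definition kernel n m : R :=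
  \prod_(1 <= j < n.+1) ((j%:R - x) / ((j + m)%:R - x)).

Lemma natrSB_gt0 n : 0 < n.+1%:R - x.
Proof.
case/andP: x01 => _ x1; rewrite subr_gt0 (lt_le_trans x1)//.
by rewrite ler1n.
Qed.

Let neq0 n : n.+1%:R - x != 0. Proof. exact/lt0r_neq0/natrSB_gt0. Qed.

Lemma kernel0n m : kernel 0 m = 1. Proof. by rewrite /kernel big_geq. Qed.

Lemma kernelSn n m :
  kernel n.+1 m = kernel n m * ((n.+1%:R - x) / ((n + m).+1%:R - x)).
Proof. by rewrite /kernel big_nat_recr. Qed.

Lemma kernelnS n m :
  kernel n m.+1 = kernel n m * ((m.+1%:R - x) / ((n + m).+1%:R - x)).
Proof.
elim: n => [|n IHn]; first by rewrite !kernel0n mul1r divff.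
rewrite !kernelSn IHn addnS addSn -!mulrA; congr (_ * _).
ring.
Qed.

(** The product is not visibly symmetric, but [kernelSn] and [kernelnS] are the same recurrence in
    the two arguments, with common starting value 1. *)
Lemma kernelC n m : kernel n m = kernel m n.
Proof.
elim: m => [|m IHm]; last by rewrite kernelnS kernelSn IHm addnC.
elim: n => [|n IHn]; rewrite ?kernel0n// kernelSn IHn addn0 divff// mulr1.
by rewrite kernel0n.
Qed.

Lemma kernel_ge0 n m : 0 <= kernel n m.
Proof.
elim: n => [|n IHn]; first by rewrite kernel0n.
by rewrite kernelSn mulr_ge0// divr_ge0// ltW// natrSB_gt0.
Qed.

(** The source of every transport: after division by m, it writes C(n + 1, m) / (n + 1 - x) as a
    difference in n, which telescopes. *)
Lemma kernelBS n m :
  kernel n m - kernel n.+1 m = (n.+1%:R - x)^-1 * kernel n.+1 m * m%:R.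
Proof.
rewrite kernelSn; have h1 := neq0 n; have h2 := neq0 (n + m).
rewrite -addSn natrD in h2 *.
move: (n.+1%:R) (m%:R) h1 h2 => a b h1 h2.
by field; rewrite h1 h2.
Qed.

Lemma kernel_decr n m : kernel n.+1 m <= kernel n m.
Proof.
by rewrite -subr_ge0 kernelBS !mulr_ge0 ?kernel_ge0// invr_ge0 ltW// natrSB_gt0.
Qed.

(** By symmetry and monotonicity C(n, m + 1) <= C(1, n) = (1 - x) / (n + 1 - x) <= 1 / (n + 1). At
    second argument 0 the kernel is constantly 1, hence the successor. *)
Lemma kernel_cvg0 m : kernel n m.+1 @[n --> \oo] --> 0.
Proof.
apply: (squeeze_cvgr _ (cvg_cst 0) (@cvg_harmonic R)).
apply: nearW => n; rewrite kernel_ge0/= kernelC.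
apply: (@le_trans _ _ (kernel 1 n)).
  elim: m => // m; apply: le_trans; exact: kernel_decr.
rewrite kernelSn kernel0n mul1r add0n ler_pdivrMr ?natrSB_gt0// mulrC ler_pdivlMr//.
case/andP: x01 => x0 x1.
have : 0 <= x * n%:R by rewrite mulr_ge0.
rewrite -natr1; nra.
Qed.

Lemma esum_kernel l m :
  (\esum_(n in [set: nat]) ((l < n)%N%:R * ((n%:R - x)^-1 * kernel n m.+1))%:E
   = (kernel l m.+1 / m.+1%:R)%:E)%E.
Proof.
rewrite -(@esum_telescope _ (fun n => kernel n m.+1 / m.+1%:R) l); first last.
- rewrite -[X in _ --> X](mul0r m.+1%:R^-1).
  by apply: cvgMr_tmp; exact: kernel_cvg0.
- by move=> n; rewrite ler_pM2r ?invr_gt0 ?ltr0n// kernel_decr.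
apply: eq_esum => -[|n] _; first by rewrite !mul0r.
by rewrite /= -mulrBl kernelBS mulfK ?pnatr_eq0.
Qed.

(** Extended real values allow sums to be exchanged before any convergence is known. *)
Definition conn (f g : nat -> R) : \bar R :=
  (\esum_(n in [set: nat]) \esum_(m in [set: nat])
     (f n * g m * kernel n m)%:E)%E.

Lemma connC f g : (forall n, 0 <= f n) -> (forall n, 0 <= g n) ->
  conn f g = conn g f.
Proof.
move=> f0 g0; rewrite /conn esum_swap; last first.
  by move=> n m; rewrite lee_fin !mulr_ge0 ?kernel_ge0.
apply: eq_esum => n _; apply: eq_esum => m _.
by rewrite kernelC (mulrC (f m)).
Qed.

End Kernel.

(** The weights 1 / (n - x), x / (n (n - x)) and 1 / n give the operators W, V and A. *)
Definition psum_op {R : realType} (w f : nat -> R) (n : nat) : R :=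
  w n * \sum_(l < n) f l.

Section Transport.
Context {R : realType}.
Variable x : R.
Hypothesis x01 : 0 <= x < 1.

(** Once W f is expanded over l < n, the sum over n is taken first and [esum_kernel] evaluates it.
    That lemma covers m >= 1; the term m = 0 is removed by g 0 = 0. *)
Lemma conn_transport (f g : nat -> R) :
  (forall n, 0 <= f n) -> (forall n, 0 <= g n) -> g 0 = 0 ->
  conn x (psum_op (fun n => (n%:R - x)^-1) f) g
  = conn x f (fun n => n%:R^-1 * g n).
Proof.
move=> f0 g0 g00; rewrite /conn.
transitivity (\esum_(n in [set: nat]) \esum_(m in [set: nat])
    \esum_(l in [set: nat])
    ((f l * g m) * ((l < n)%N%:R * ((n%:R - x)^-1 * kernel x n m)))%:E)%E.
  apply: eq_esum => -[|n] _; apply: eq_esum => m _.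
    rewrite esum1 /psum_op ?big_ord0 ?mulr0 ?mul0r// => l _.
    by rewrite ltn0 mul0r mulr0.
  have -> : psum_op (fun n => (n%:R - x)^-1) f n.+1 * g m * kernel x n.+1 m =
      \sum_(l < n.+1) f l * g m * ((n.+1%:R - x)^-1 * kernel x n.+1 m).
    by rewrite /psum_op -2!mulr_suml; ring.
  rewrite (esum_nat_lt _ (F := fun l => f l * g m * _)).
    by apply: eq_esum => l _; rewrite mulrCA.
  by move=> l; rewrite !mulr_ge0 ?kernel_ge0// invr_ge0 ltW// natrSB_gt0.
(* At n = 0 the factor 1 / (n - x) may be negative, but no l satisfies l < 0. *)
have tge0 n m l :
  (0 <= (f l * g m * ((l < n)%N%:R * ((n%:R - x)^-1 * kernel x n m)))%:E)%E.
  rewrite lee_fin; case: n => [|n]; first by rewrite ltn0 mul0r mulr0.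
  by rewrite !mulr_ge0 ?kernel_ge0// invr_ge0 ltW// natrSB_gt0.
under eq_esum do rewrite esum_swap//.
rewrite esum_swap; last by move=> *; exact: esum_ge0.
apply: eq_esum => l _; rewrite esum_swap//; apply: eq_esum => -[|m] _.
  by rewrite esum1 => [|n _]; rewrite g00 !mulr0 !mul0r.
under eq_esum do rewrite EFinM.
rewrite esumZl ?mulr_ge0//; last first.
  move=> n _; rewrite lee_fin; case: n => [|n]; first by rewrite ltn0 mul0r.
  by rewrite !mulr_ge0 ?kernel_ge0// invr_ge0 ltW// natrSB_gt0.
rewrite esum_kernel// -EFinM; congr _%:E; ring.
Qed.

End Transport.

(** * Multiple zeta values as iterated sums, and duality *)

Section NestedSums.
Context {R : realType}.
Implicit Types (f g w : nat -> R) (ws : seq (nat -> R)) (k L : seq nat).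

(** The indicator of 0 acts as a last variable n_(d+1) = 0: its sum over l < n is 1 for n >= 1 and 0
    for n = 0. *)
Definition nest ws : nat -> R := foldr psum_op (fun n => (n == 0)%N%:R) ws.

Definition invpow (p n : nat) : R := n%:R ^- p.

Definition zterm k : nat -> R := nest [seq invpow p | p <- k].

Definition tsum f : \bar R := (\esum_(n in [set: nat]) (f n)%:E)%E.

Lemma psum_op0 w f : psum_op w f 0 = 0.
Proof. by rewrite /psum_op big_ord0 mulr0. Qed.

Lemma psum_op_ge0 w f : (forall n, 0 <= w n.+1) -> (forall n, 0 <= f n) ->
  forall n, 0 <= psum_op w f n.
Proof.
move=> w0 f0 [|n]; first by rewrite psum_op0.
by rewrite mulr_ge0// sumr_ge0.
Qed.

Lemma le_psum_op w w' f f' :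
  (forall n, 0 <= w n.+1 <= w' n.+1) -> (forall n, 0 <= f n <= f' n) ->
  forall n, 0 <= psum_op w f n <= psum_op w' f' n.
Proof.
move=> ww' ff' [|n]; first by rewrite !psum_op0 lexx.
have w0 m : 0 <= w m.+1 by case/andP: (ww' m).
have f0 m : 0 <= f m by case/andP: (ff' m).
rewrite psum_op_ge0//= ler_pM ?sumr_ge0//; first by case/andP: (ww' n).
by apply: ler_sum => m _; case/andP: (ff' m).
Qed.

Lemma invpow_ge0 p n : 0 <= invpow p n.
Proof. by rewrite invr_ge0 exprn_ge0. Qed.

Lemma zterm_ge0 k n : 0 <= zterm k n.
Proof.
elim: k n => [|p k IHk] n; first by rewrite /zterm/= ler0n.
by apply: psum_op_ge0 => // m; exact: invpow_ge0.
Qed.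

Lemma zterm_consS p k n : zterm (p.+1 :: k) n = n%:R^-1 * zterm (p :: k) n.
Proof.
by rewrite /zterm /= /psum_op mulrA -invfM -exprS.
Qed.

(** The set A constrains the largest variable; in the induction it becomes the set of l < n. The
    default head 0 of the empty tuple agrees with the indicator of 0. *)
Lemma esum_mzv_domain k (A : set nat) :
  (\esum_(s in [set s | mzv_domain (size k) s /\ A (head 0%N s)])
     (\prod_(p <- zip s k) p.1%:R ^- p.2)%:E
   = \esum_(l in A) (zterm k l)%:E)%E.
Proof.
elim: k A => [|p k IHk] A.
  rewrite (esumID [set 0%N]); last by move=> i _; rewrite lee_fin zterm_ge0.
  rewrite [X in (_ + X)%E]esum1; last by move=> [|n] [_ nn] //; case: nn.
  rewrite adde0.
  have [A0|nA0] := pselect (A 0%N).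
    rewrite (_ : [set s | _] = [set [::]]); last first.
      by apply/seteqP; split => [s [[/size0nil ->]]|_ ->] //; split.
    rewrite (_ : A `&` _ = [set 0%N]); last first.
      by apply/seteqP; split => [n []|_ ->] //; split.
    by rewrite !esum_set1 ?big_nil ?lee_fin// zterm_ge0.
  rewrite (_ : [set s | _] = set0); last first.
    by apply/seteqP; split => s // [[/size0nil ->]].
  rewrite (_ : A `&` _ = set0) ?esum_set0//.
  by apply/seteqP; split => n // [An n0]; apply: nA0; rewrite -n0.
transitivity (\esum_(n in A `&` [set n | 0 < n]%N)
   \esum_(t in [set t | mzv_domain (size k) t /\ `I_n (head 0%N t)])
   (invpow p n * \prod_(q <- zip t k) q.1%:R ^- q.2)%:E)%E.
  rewrite esum_esum; last first.
    move=> n t _ _; rewrite lee_fin; apply: mulr_ge0; first exact: invpow_ge0.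
    by apply: prodr_ge0 => q _; exact: (invpow_ge0 q.2 q.1).
  have bij : set_bij ((A `&` [set n | 0 < n]%N) `*``
      (fun n => [set t | mzv_domain (size k) t /\ `I_n (head 0%N t)]))
      [set s | mzv_domain (size (p :: k)) s /\ A (head 0%N s)]
      (fun q => q.1 :: q.2).
  split.
  - move=> [n [|m t]] /= [[An n0]] [[/= szt st post] mn].
      by split; [split; rewrite /= -?szt ?n0|].
    split; [split|] => //=; [by rewrite -szt|by rewrite mn|].
    by rewrite n0 post.
  - by move=> [n t] [n' t'] _ _ /= [-> ->].
  - move=> [|n t] [] [//= [szt] st /andP[n0 post] An].
    exists (n, t) => //; split=> //=; split.
      by split=> //; case: t st {szt post} => //= m t /andP[].
    by case: t st {szt post} => //= m t /andP[].
  rewrite (reindex_esum _ _ _ _ bij).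
  by apply: eq_esum => -[n t] _ /=; rewrite big_cons.
rewrite esum_mkcondr; apply: eq_esum => -[|n] _.
  by rewrite memNset//= /zterm/= psum_op0.
rewrite mem_set//; under eq_esum do rewrite EFinM.
rewrite esumZl ?invpow_ge0//; last first.
  move=> t _; rewrite lee_fin; apply: prodr_ge0 => q _.
  exact: (invpow_ge0 q.2 q.1).
rewrite IHk esum_fset//; last by move=> i _; rewrite lee_fin zterm_ge0.
by rewrite -fsbig_ord sumEFin -EFinM.
Qed.

Lemma mzvE k : mzv R k = fine (tsum (zterm k)).
Proof.
rewrite /mzv /tsum -(esum_mzv_domain _ [set: nat]).
by congr (fine (esum _ _)); apply/seteqP; split => s // [].
Qed.

(** Only m = 0 contributes, and C(n, 0) = 1. *)
Lemma conn_zterm_nil f (x : R) : (forall n, 0 <= f n) -> 0 <= x < 1 ->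
  conn x f (zterm [::]) = tsum f.
Proof.
move=> f0 x01; apply: eq_esum => n _.
rewrite (esumID [set 0%N]); last first.
  by move=> m _; rewrite lee_fin !mulr_ge0 ?kernel_ge0 ?zterm_ge0.
rewrite [X in (_ + X)%E]esum1; last first.
  by move=> [|m] [_ mm]; [case: mm|rewrite /zterm/= mulr0 mul0r].
rewrite adde0 setTI esum_set1; last first.
  by rewrite lee_fin !mulr_ge0 ?kernel_ge0 ?zterm_ge0.
by rewrite kernelC// kernel0n// !mulr1.
Qed.

End NestedSums.

Section Duality.
Context {R : realType}.
Implicit Types (k r L : seq nat).

Local Notation conn0 k L := (conn (0 : R) (zterm k) (zterm L)).

Let x01 : 0 <= (0 : R) < 1. Proof. by rewrite lexx ltr01. Qed.

(** At x = 0 the weight 1 / (n - x) is that of an entry 1, so this is [conn_transport]; the right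
    index is nonempty so that its term vanishes at 0. *)
Lemma conn0_drop1 k p L : conn0 (1%N :: k) (p :: L) = conn0 k (p.+1 :: L).
Proof.
have -> : zterm (1%N :: k) = psum_op (fun n => (n%:R - (0 : R))^-1) (zterm k).
  by apply/funext => n; rewrite /psum_op subr0.
rewrite conn_transport//; try exact: zterm_ge0; last exact: psum_op0.
by congr conn; apply/funext => n; rewrite zterm_consS.
Qed.

Lemma conn0_decr p k L : conn0 (p.+1 :: k) L = conn0 (p :: k) (1%N :: L).
Proof.
rewrite connC//; try exact: zterm_ge0.
rewrite [RHS]connC//; try exact: zterm_ge0.
have -> : zterm (1%N :: L) = psum_op (fun n => (n%:R - (0 : R))^-1) (zterm L).
  by apply/funext => n; rewrite /psum_op subr0.
rewrite [RHS]conn_transport//; try exact: zterm_ge0; last exact: psum_op0.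
by congr conn; apply/funext => n; rewrite zterm_consS.
Qed.

Lemma conn0_drop_ones b k p L :
  conn0 (nseq b 1%N ++ k) (p :: L) = conn0 k (p + b :: L)%N.
Proof.
elim: b p => [|b IHb] p; first by rewrite addn0.
by rewrite conn0_drop1 IHb addSnnS.
Qed.

Lemma conn0_decr_iter a p k L :
  conn0 (p + a :: k)%N L = conn0 (p :: k) (nseq a 1%N ++ L).
Proof.
elim: a p => [|a IHa] p; first by rewrite addn0.
by rewrite -addSnnS IHa conn0_decr.
Qed.

(** In a block (k_i + 1, 1, ..., 1), lowering the head to 1 leaves k_i ones on the right. The r_i
    ones now on the left merge into the first of these, giving r_i + 1 followed by k_i - 1 ones. *)
Lemma conn0_pad k r L : size k = size r -> is_index k -> is_index r ->
  conn0 (index_pad k r) L =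
  conn0 [::] (flatten (rev [seq p.2.+1 :: nseq p.1.-1 1%N | p <- zip k r]) ++ L).
Proof.
rewrite /index_pad.
elim: k r L => [|[//|a] k IHk] [|[//|b] r] //= L [szkr] idk idr.
rewrite rev_cons flatten_rcons -catA -IHk// -[a.+2]/(1 + a.+1)%N.
by rewrite conn0_decr_iter/= (conn0_drop_ones b.+1) add1n.
Qed.

(** At both ends of the transport one index is empty and the connected sum is a plain sum. The
    equality is one of extended reals, so it also transfers finiteness. *)
Lemma tsum_pad_dual k r : size k = size r -> is_index k -> is_index r ->
  tsum (zterm (index_pad k r) : nat -> R) =
  tsum (zterm (flatten (rev [seq p.2.+1 :: nseq p.1.-1 1%N | p <- zip k r]))).
Proof.
move=> szkr idk idr; rewrite -(@conn_zterm_nil _ _ 0)//; last exact: zterm_ge0.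
rewrite conn0_pad// cats0 connC//; try exact: zterm_ge0.
by rewrite conn_zterm_nil//; exact: zterm_ge0.
Qed.

Lemma tsum_mono (f g : nat -> R) : (forall n, f n <= g n) ->
  (tsum f <= tsum g)%E.
Proof. by move=> fg; apply: le_esum => n _; rewrite lee_fin. Qed.

Lemma le_invpow p q n : (p <= q)%N -> invpow q n.+1 <= invpow p n.+1 :> R.
Proof.
move=> pq; rewrite /invpow lef_pV2 ?posrE ?exprn_gt0//.
by rewrite ler_weXn2l ?ler1n.
Qed.

Lemma tsum_zterm2_fin : (tsum (zterm [:: 2%N] : nat -> R) < +oo)%E.
Proof.
(* Here u n - u (n + 1) = 2 / ((n + 1) (n + 2)) >= (n + 1)^-2. *)
pose u n : R := 2 / n.+1%:R.
apply: (@le_lt_trans _ _ (u 0)%:E); last exact: ltry.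
rewrite -(@esum_telescope _ u 0).
- apply: le_esum => -[|n] _; rewrite lee_fin; first by rewrite mul0r [leLHS]psum_op0.
  rewrite /zterm/= /psum_op big_ord_recl/= big1// addr0 mulr1 mul1r.
  rewrite /invpow /u -(natr1 n.+1).
  have : 1 <= n.+1%:R :> R by rewrite ler1n.
  move: (n.+1%:R : R) => a a1; rewrite -subr_ge0.
  have -> : 2 / a - 2 / (a + 1) - a ^- 2 = (a - 1) / (a ^+ 2 * (a + 1)).
    by field; rewrite !gt_eqF; lra.
  by rewrite divr_ge0 ?subr_ge0// mulr_ge0 ?exprn_ge0//; lra.
- by move=> n; rewrite /u ler_pM2l// lef_pV2 ?posrE// ler_nat.
- rewrite -(mulr0 (2 : R)); apply: cvgMl_tmp; exact: cvg_harmonic.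
Qed.

(** Lowering the entries bounds the sum by that of (2, 1, ..., 1), of some depth d; duality turns
    this into zeta(d + 1) <= zeta(2). *)
Lemma tsum_zterm_fin p k : (1 < p)%N -> is_index k ->
  (tsum (zterm (p :: k) : nat -> R) < +oo)%E.
Proof.
move=> p1 idk.
apply: (@le_lt_trans _ _ (tsum (zterm (2 :: nseq (size k) 1)%N : nat -> R))).
  apply: tsum_mono => n.
  suff : 0 <= (zterm (p :: k) n : R) <= zterm (2 :: nseq (size k) 1)%N n.
    by case/andP.
  apply: le_psum_op => m; first by rewrite invpow_ge0 le_invpow.
  elim: k idk m => [|q k IHk] /= idk m; first by rewrite lexx ler0n.
  case/andP: idk => q0 idk; apply: le_psum_op => l; last exact: IHk.
  by rewrite invpow_ge0 le_invpow.
have := @tsum_pad_dual [:: 1%N] [:: (size k).+1] erefl erefl erefl.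
rewrite /index_pad /= !cats0 => ->.
apply: le_lt_trans tsum_zterm2_fin; apply: tsum_mono => n.
suff : 0 <= (zterm [:: (size k).+2] n : R) <= zterm [:: 2]%N n
  by case/andP.
apply: le_psum_op => m; first by rewrite invpow_ge0 le_invpow.
by rewrite lexx ler0n.
Qed.

End Duality.

(** * Transporting the operators: expansion over refinements *)

Section RefinementExpansion.
Context {R : realType}.
Implicit Types (f g : nat -> R) (k l ks : seq nat) (L : seq (seq nat)).
Variable x : R.
(** For n >= 1 this gives 1 / (n - x) <= 2 / n and x / (n - x) <= 1 / n, on which the convergence
    arguments rest. *)
Hypothesis x_half : 0 <= x <= 2^-1.

Let x01 : 0 <= x < 1.
Proof. by case/andP: x_half => -> /le_lt_trans -> //; lra. Qed.

(** For n >= 1, the sum of x^s n^-(p + s) over s >= 1. *)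
Definition cut_weight (p n : nat) : R := n%:R ^- p * (x / (n%:R - x)).

Definition bterm k : nat -> R := nest [seq cut_weight p | p <- k].

Let W f : nat -> R := psum_op (fun n => (n%:R - x)^-1) f.
Let V f : nat -> R := psum_op (cut_weight 1) f.
Let A f : nat -> R := psum_op (invpow 1) f.

Lemma cut_weight_ge0 p n : 0 <= cut_weight p n.+1.
Proof.
case/andP: x01 => x0 _.
by rewrite mulr_ge0 ?invr_ge0 ?exprn_ge0// divr_ge0// ltW// natrSB_gt0.
Qed.

Let W_ge0 f : (forall n, 0 <= f n) -> forall n, 0 <= W f n.
Proof.
by move=> f0; apply: psum_op_ge0 => // n; rewrite invr_ge0 ltW// natrSB_gt0.
Qed.

Let V_ge0 f : (forall n, 0 <= f n) -> forall n, 0 <= V f n.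
Proof. by move=> f0; apply: psum_op_ge0 => // n; exact: cut_weight_ge0. Qed.

Let A_ge0 f : (forall n, 0 <= f n) -> forall n, 0 <= A f n.
Proof. by move=> f0; apply: psum_op_ge0 => // n; exact: invpow_ge0. Qed.

Lemma bterm_ge0 k n : 0 <= bterm k n.
Proof.
elim: k n => [|p k IHk] n; first by rewrite /bterm/= ler0n.
by apply: psum_op_ge0 => // m; exact: cut_weight_ge0.
Qed.

Lemma bterm_consS p k n : bterm (p.+1 :: k) n = n%:R^-1 * bterm (p :: k) n.
Proof. by rewrite /bterm /= /psum_op /cut_weight exprS invfM !mulrA. Qed.

(** As V f = W (x f) / n, two transports pass through the middle form Z(W (x f), W g), and the
    scalar x then changes sides. *)
Lemma conn_cut f g : (forall n, 0 <= f n) -> (forall n, 0 <= g n) ->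
  conn x (V f) g = conn x f (V g).
Proof.
move=> f0 g0; case/andP: x01 => x0 _.
pose xf n := x * f n.
have xf0 n : 0 <= xf n by rewrite mulr_ge0.
have nW0 h : (forall n, 0 <= h n) -> forall n, 0 <= n%:R^-1 * W h n.
  by move=> h0 n; rewrite mulr_ge0 ?invr_ge0// W_ge0.
transitivity (conn x (fun n => n%:R^-1 * W xf n) g).
  congr (conn x _ g); apply/funext => n.
  rewrite /V /W /psum_op /cut_weight /xf -mulr_sumr expr1.
  by rewrite -!mulrA; congr (_ * _); rewrite mulrCA.
rewrite connC//; last exact: nW0.
rewrite -conn_transport//; [|exact: W_ge0|exact: psum_op0].
rewrite connC//; try exact: W_ge0.
rewrite conn_transport//; [|exact: W_ge0|exact: psum_op0].
apply: eq_esum => n _; apply: eq_esum => m _.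
congr (_ * _)%:E; rewrite /V /W /psum_op /cut_weight /xf expr1.
move: (\sum_(l < m) g l) (m%:R - x) => S y; ring.
Qed.

Lemma connDl f f' g : (forall n, 0 <= f n) -> (forall n, 0 <= f' n) ->
  (forall n, 0 <= g n) ->
  (conn x (fun n => f n + f' n)%R g = conn x f g + conn x f' g)%E.
Proof.
move=> f0 f'0 g0; rewrite /conn -esumD; last 2 first.
- by move=> n _; apply: esum_ge0 => m _; rewrite lee_fin !mulr_ge0 ?kernel_ge0.
- by move=> n _; apply: esum_ge0 => m _; rewrite lee_fin !mulr_ge0 ?kernel_ge0.
apply: eq_esum => n _; rewrite -esumD; last 2 first.
- by move=> m _; rewrite lee_fin !mulr_ge0 ?kernel_ge0.
- by move=> m _; rewrite lee_fin !mulr_ge0 ?kernel_ge0.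
by apply: eq_esum => m _; rewrite -EFinD !mulrDl.
Qed.

Lemma conn_ge0 f g : (forall n, 0 <= f n) -> (forall n, 0 <= g n) ->
  (0 <= conn x f g)%E.
Proof.
move=> f0 g0; apply: esum_ge0 => n _; apply: esum_ge0 => m _.
by rewrite lee_fin !mulr_ge0 ?kernel_ge0.
Qed.

(** Since 1 / n + x / (n (n - x)) = 1 / (n - x), A f + V f = W f, which transport moves. The
    additive form avoids subtracting infinities. *)
Lemma conn_merge_or_cut f g :
  (forall n, 0 <= f n) -> (forall n, 0 <= g n) -> g 0 = 0 ->
  (conn x (A f) g + conn x f (V g) = conn x f (fun n => n%:R^-1 * g n)%R)%E.
Proof.
move=> f0 g0 g00; rewrite -conn_cut// -connDl//; [|exact: A_ge0|exact: V_ge0].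
rewrite -conn_transport//; congr (conn x _ g); apply/funext => -[|n].
  by rewrite /A /V !psum_op0 addr0.
rewrite /A /V /psum_op -mulrDl /invpow /cut_weight expr1; congr (_ * _).
have := natrSB_gt0 x01 n; have := ltr0Sn R n.
by move: (n.+1%:R : R) => a a0 ax; field; rewrite !gt_eqF.
Qed.

(** Here W f <= 2 A f because x <= 1/2. Thus finiteness of Z(A f, g) spreads to the whole identity
    [conn_merge_or_cut], which may then be solved for Z(A f, g). *)
Lemma conn_merge_fin f g :
  (forall n, 0 <= f n) -> (forall n, 0 <= g n) -> g 0 = 0 ->
  (conn x (A f) g < +oo -> conn x f (fun n => n%:R^-1 * g n)%R < +oo)%E.
Proof.
move=> f0 g0 g00 Afg; rewrite -conn_transport//.
apply: (@le_lt_trans _ _ (conn x (A f) g + conn x (A f) g)%E); last first.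
  exact: lte_add_pinfty.
rewrite -connDl//; try exact: A_ge0.
apply: le_esum => n _; apply: le_esum => m _; rewrite lee_fin.
rewrite ler_wpM2r ?kernel_ge0// ler_wpM2r//.
case: n => [|n]; first by rewrite /A !psum_op0 addr0.
rewrite /A /psum_op -mulrDl ler_wpM2r ?sumr_ge0// /invpow expr1.
have n1 : 1 <= n.+1%:R :> R by rewrite ler1n.
case/andP: x_half => x0 xh.
move: (n.+1%:R : R) n1 => a a1.
rewrite -subr_ge0.
have -> : a^-1 + a^-1 - (a - x)^-1 = (a - 2 * x) / (a * (a - x)).
  by field; rewrite !gt_eqF; lra.
by rewrite divr_ge0 ?mulr_ge0; lra.
Qed.

(** The value at [[::]] is harmless: [refine_block] prepends a 1 before the first step. *)
Definition incr_head k := if k is p :: k' then p.+1 :: k' else [::].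

Definition refine_step L := map incr_head L ++ map (cons 1%N) L.

(** One V opens an entry 1 and q - 1 operators A place the remaining units, so that every
    composition of q appears in front of the members of L. *)
Definition refine_block L (q : nat) :=
  iter q.-1 refine_step (map (cons 1%N) L).

Definition refinements k := foldr (fun q L => refine_block L q) [:: [::]] k.

Definition signed_conn f L : R :=
  \sum_(l <- L) (-1) ^+ size l * fine (conn x f (bterm l)).

(** Carried through every step, because [fine] is additive only on finite values. *)
Definition conn_fin f L : Prop :=
  forall l, l \in L -> (conn x f (bterm l) < +oo)%E.

Lemma signed_conn_cut f L : (forall n, 0 <= f n) -> conn_fin (V f) L ->
  signed_conn (V f) L = - signed_conn f (map (cons 1%N) L)
  /\ conn_fin f (map (cons 1%N) L).
Proof.
move=> f0 finL; split.
  rewrite /signed_conn big_map -sumrN; apply: eq_bigr => l _.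
  by rewrite conn_cut//= ?exprS ?mulN1r ?mulNr ?opprK//; exact: bterm_ge0.
move=> _ /mapP[l lL ->].
by have := finL _ lL; rewrite conn_cut//; exact: bterm_ge0.
Qed.

(** [conn_merge_or_cut] solved for its first term; the minus sign of the new entry is absorbed by
    the parity of the length. The empty index is excluded as its term is 1 at 0. *)
Lemma signed_conn_step f L : (forall n, 0 <= f n) -> [::] \notin L ->
  conn_fin (A f) L ->
  signed_conn (A f) L = signed_conn f (refine_step L)
  /\ conn_fin f (refine_step L).
Proof.
move=> f0 nilL finL.
have incrE p l : bterm (p.+1 :: l) = fun n => n%:R^-1 * bterm (p :: l) n.
  by apply/funext => n; exact: bterm_consS.
have g00 p l : bterm (p :: l) 0 = 0 by exact: psum_op0.
have merge p l := conn_merge_or_cut f0 (bterm_ge0 (p :: l)) (g00 p l).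
have finc p l : p :: l \in L ->
    (conn x f (bterm (p.+1 :: l)) < +oo)%E /\
    (conn x f (bterm (1%N :: p :: l)) < +oo)%E.
  move=> /finL plL.
  have finm : (conn x f (bterm (p.+1 :: l)) < +oo)%E.
    by rewrite (incrE p l); apply: conn_merge_fin => //; exact: bterm_ge0.
  split=> //; apply: le_lt_trans finm.
  rewrite (incrE p l) -merge; apply: leeDr.
  by apply: conn_ge0; [exact: A_ge0|exact: bterm_ge0].
split.
  rewrite /signed_conn /refine_step big_cat/= !big_map -big_split/=.
  rewrite !big_seq; apply: eq_bigr => -[|p l] lL; first by rewrite lL in nilL.
  have [_ fin1] := finc _ _ lL.
  have finA := finL _ lL.
  rewrite (incrE p l) -merge fineD; last 2 first.
  - by rewrite ge0_fin_numE// conn_ge0//; [exact: A_ge0|exact: bterm_ge0].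
  - by rewrite ge0_fin_numE// conn_ge0//; exact: (bterm_ge0 (1%N :: p :: l)).
  by rewrite [in X in _ + X]/= !exprS; ring.
move=> m; rewrite mem_cat => /orP[] /mapP[[|p l] lL ->].
- by rewrite lL in nilL.
- by case: (finc _ _ lL).
- by rewrite lL in nilL.
- by case: (finc _ _ lL).
Qed.

Lemma nil_notin_step L : [::] \notin L -> [::] \notin refine_step L.
Proof.
move=> nilL; rewrite mem_cat negb_or; apply/andP; split; last first.
  by apply/mapP => -[].
by apply/mapP => -[[|p l] lL]//; rewrite lL in nilL.
Qed.

Lemma signed_conn_block f q L : (forall n, 0 <= f n) ->
  conn_fin (V (iter q.-1 A f)) L ->
  signed_conn (V (iter q.-1 A f)) L = - signed_conn f (refine_block L q)
  /\ conn_fin f (refine_block L q).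
Proof.
rewrite /refine_block; move: q.-1 => {}q f0 finL.
have itA0 j n : 0 <= iter j A f n by elim: j n => //= j; exact: A_ge0.
have [-> {}finL] := signed_conn_cut (itA0 q) finL.
have nilL : [::] \notin map (cons 1%N) L by apply/mapP => -[].
elim: q (map _ _) nilL finL => [|q IHq] L' nilL finL //.
have [-> finL1] := signed_conn_step (itA0 q) nilL finL.
by rewrite iterSr; apply: IHq => //; exact: nil_notin_step.
Qed.

Lemma nest_nseq_cat q w (ws : seq (nat -> R)) :
  nest (nseq q w ++ ws) = iter q (psum_op w) (nest ws).
Proof. by elim: q => //= q ->. Qed.

(* A block (p, q) stands for an entry n^-p x / (n - x), the generating function
   of the n^-(p + s) with s >= 1, followed by q entries n^-1. *)
Definition block_term (bs : seq (nat * nat)) : nat -> R :=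
  nest (flatten [seq cut_weight b.1 :: nseq b.2 (invpow 1) | b <- bs]).

Lemma block_term_ge0 bs n : 0 <= block_term bs n.
Proof.
elim: bs n => [|[p q] bs IHbs] n; first by rewrite /block_term/= ler0n.
rewrite /block_term/= nest_nseq_cat.
apply: psum_op_ge0 => {n} [n|]; first exact: cut_weight_ge0.
by elim: q => //= q IHq m; apply: A_ge0.
Qed.

Lemma signed_conn_blocks ks L :
  conn_fin (block_term [seq (1, q.-1)%N | q <- ks]) L ->
  signed_conn (block_term [seq (1, q.-1)%N | q <- ks]) L =
    (-1) ^+ size ks * signed_conn (nest [::]) (foldl refine_block L ks)
  /\ conn_fin (nest [::]) (foldl refine_block L ks).
Proof.
elim: ks L => [|q ks IHks] L finL; first by rewrite mul1r.
have E : block_term [seq (1, q.-1)%N | q <- q :: ks] =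
    V (iter q.-1 A (block_term [seq (1, q.-1)%N | q <- ks])).
  by rewrite /block_term/= nest_nseq_cat.
rewrite E in finL *.
have [-> finL1] := signed_conn_block (block_term_ge0 _) finL.
have [-> finL2] := IHks _ finL1.
by rewrite exprS mulN1r mulNr.
Qed.

(** As x / (n - x) <= 1 / n, [cut_weight p] is at most the weight of an entry p + 1, which is at
    least 2 for p >= 1. *)
Lemma block_term_le bs n : all (fun b => 0 < b.1)%N bs ->
  block_term bs n <=
  zterm (flatten [seq b.1.+1 :: nseq b.2 1%N | b <- bs]) n.
Proof.
move=> bs0; suff : 0 <= block_term bs n <=
  zterm (flatten [seq b.1.+1 :: nseq b.2 1%N | b <- bs]) n by case/andP.
elim: bs n bs0 => [|[p q] bs IHbs] n /=; first by rewrite lexx ler0n.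
case/andP => p0 bs0; rewrite /zterm/= map_cat map_nseq /block_term/=.
apply: le_psum_op => m.
  rewrite cut_weight_ge0 /cut_weight /invpow exprSr invfM ler_wpM2l//.

  case/andP: x_half => x0 xh.
  have n1 : 1 <= m.+1%:R :> R by rewrite ler1n.
  move: (m.+1%:R : R) n1 => a a1.
  rewrite ler_pdivrMr ?subr_gt0; last lra.
  rewrite mulrC ler_pdivlMr; last lra.
  nra.
rewrite !nest_nseq_cat; elim: q m => [|q IHq] m; first exact: IHbs.
by apply: le_psum_op => // i; rewrite invpow_ge0 lexx.
Qed.

Lemma tsum_block_fin b bs : all (fun b => 0 < b.1)%N (b :: bs) ->
  (tsum (block_term (b :: bs)) < +oo)%E.
Proof.
move=> bs0; apply: le_lt_trans.
  by apply: tsum_mono => n; exact: block_term_le.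
move: bs0 => /=/andP[b0 bs0]; apply: tsum_zterm_fin; first by rewrite ltnS.
rewrite /is_index all_cat all_nseq orbT/= {bs0}.
by elim: bs => //= -[p q] bs IHbs; rewrite /= all_cat all_nseq orbT.
Qed.

Lemma bterm_block k : bterm k = block_term [seq (p, 0)%N | p <- k].
Proof.
by rewrite /bterm /block_term -map_comp; elim: k => //= p k ->.
Qed.

(** The outermost block, that of k_d, crosses first and ends up as the tail of each refinement;
    hence the left fold over [rev k] is the right fold in [refinements]. Each V contributes one
    sign, in total (-1)^d. *)
Lemma fine_tsum_refinements k : (0 < size k)%N ->
  fine (tsum (block_term [seq (1, q.-1)%N | q <- rev k])) =
  \sum_(l <- refinements k)
    (-1) ^+ (size k + size l) * fine (tsum (bterm l)).
Proof.
move=> sk.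
have finA : conn_fin (block_term [seq (1, q.-1)%N | q <- rev k]) [:: [::]].
  move=> l; rewrite inE => /eqP ->.
  rewrite (@conn_zterm_nil _ _ x)//; last exact: block_term_ge0.
  have : (0 < size (rev k))%N by rewrite size_rev.
  case: (rev k) => // q ks _ /=; apply: tsum_block_fin => /=.
  by rewrite all_map; apply/allP.
have [+ _] := signed_conn_blocks finA.
rewrite /signed_conn big_seq1 mul1r (@conn_zterm_nil _ _ x)//; last first.
  exact: block_term_ge0.
move=> ->; rewrite foldl_rev size_rev mulr_sumr; apply: eq_bigr => l _.
have nil0 n : 0 <= nest [::] n :> R by rewrite ler0n.
have b0 := bterm_ge0 l.
by rewrite mulrA -exprD connC// (@conn_zterm_nil _ (bterm l) x)//; exact: bterm_ge0.
Qed.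

End RefinementExpansion.

(** * Generating functions *)

Section GeneratingFunctions.
Context {R : realType}.
Implicit Types (bs : seq (nat * nat)) (rs : seq nat).
Local Open Scope ereal_scope.

Definition block_index bs rs : seq nat :=
  flatten [seq (p.1.1 + p.2)%N :: nseq p.1.2 1%N | p <- zip bs rs].

Lemma esum_psum_op (T : choiceType) (I : set T) (w : nat -> R)
    (F : T -> nat -> R) (f : nat -> R) :
  (forall n, 0 <= w n.+1)%R -> (forall t n, 0 <= F t n)%R ->
  (forall n, \esum_(t in I) (F t n)%:E = (f n)%:E) ->
  forall n, \esum_(t in I) (psum_op w (F t) n)%:E = (psum_op w f n)%:E.
Proof.
move=> w0 F0 Ff [|n].
  by rewrite psum_op0 esum1// => t _; rewrite psum_op0.
rewrite /psum_op; under eq_esum do rewrite EFinM.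
rewrite esumZl//; last by move=> t _; rewrite lee_fin sumr_ge0.
under eq_esum do rewrite -sumEFin.
rewrite esum_sum => [|t l _ _]; last by rewrite lee_fin.
by rewrite (eq_bigr _ (fun (l : 'I_n.+1) _ => Ff l)) sumEFin -EFinM.
Qed.

Lemma esum_geometric_weight (x : R) p n : (0 <= x <= 2^-1)%R ->
  \esum_(s in [set s | 0 < s]%N) (x ^+ s * invpow (p + s) n.+1)%:E =
  (cut_weight x p n.+1)%:E.
Proof.
case/andP => x0 xh.
have a1 : (1 <= n.+1%:R :> R)%R by rewrite ler1n.
rewrite /cut_weight /invpow; move: (n.+1%:R : R) a1 => a a1.
pose y := (x / a)%R.
(* Scaled so that u (s - 1) - u s = x^s a^-(p + s) for s >= 1. *)
pose u s : R := (a ^- p * (x / (a - x)) * y ^+ s)%R.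
have y0 : (0 <= y)%R by rewrite divr_ge0//; lra.
have y1 : (y < 1)%R by rewrite ltr_pdivrMr ?mul1r; lra.
have cge0 : (0 <= a ^- p * (x / (a - x)))%R.
  by rewrite mulr_ge0 ?invr_ge0 ?exprn_ge0 ?divr_ge0//; lra.
rewrite -[RHS]/((_ : R)%:E) -(mulr1 (a ^- p * (x / (a - x)))%R).
rewrite -(expr0 y) -/(u 0%N) -(@esum_telescope _ u 0).
- rewrite esum_mkcond; apply: eq_esum => -[|s] _.
    by rewrite memNset//= mul0r.
  rewrite mem_set//= mul1r /u; congr _%:E.
  have ax : (a - x != 0)%R by rewrite gt_eqF//; lra.
  have an0 : (a != 0)%R by rewrite gt_eqF//; lra.
  rewrite exprD !exprS /y expr_div_n.
  have := expf_neq0 p an0; have := expf_neq0 s an0.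
  move: (a ^+ p)%R (a ^+ s)%R (x ^+ s)%R => ap as_ xs as0 ap0.
  by field; rewrite ?ax ?an0 ?as0 ?ap0.
- move=> s; rewrite /u ler_wpM2l// exprS ler_piMl ?exprn_ge0//; exact: ltW.
- rewrite -(mulr0 (a ^- p * (x / (a - x)))%R); apply: cvgMl_tmp.
  by apply: cvg_expr; rewrite ger0_norm.
Qed.

Definition all_indices (d : nat) : set (seq nat) :=
  [set rs | is_index rs /\ size rs = d].

(** Induction on the blocks: the sum over the first entry s is the geometric series of [cut_weight],
    and the sum over the other entries passes through the operators by [esum_psum_op]. *)
Lemma esum_block_index (x : R) bs n : (0 <= x <= 2^-1)%R ->
  \esum_(rs in all_indices (size bs))
     (x ^+ sumn rs * zterm (block_index bs rs) n)%:E =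
  (block_term x bs n)%:E.
Proof.
move=> xh; have x0 : (0 <= x)%R by case/andP: xh.
elim: bs n => [|[p q] bs IHbs] n.
  rewrite (_ : all_indices _ = [set [::]]); last first.
    by apply/seteqP; split => [rs [_ /size0nil ->]|_ ->] //; split.
  by rewrite esum_set1 ?mul1r// lee_fin ler0n.
pose tail (rs : seq nat) : nat -> R :=
  iter q (psum_op (invpow 1)) (zterm (block_index bs rs)).
have tail0 rs m : (0 <= tail rs m)%R.
  rewrite {}/tail; elim: q m => [|q' IHq] m; first exact: zterm_ge0.
  by apply: psum_op_ge0 => // i; exact: invpow_ge0.
have headE s rs m : zterm (block_index ((p, q) :: bs) (s :: rs)) m =
    psum_op (invpow (p + s)) (tail rs) m.
  by rewrite /zterm /block_index/= map_cat map_nseq nest_nseq_cat.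
have tailE m : \esum_(rs in all_indices (size bs))
    (x ^+ sumn rs * tail rs m)%:E
    = (iter q (psum_op (invpow 1)) (block_term x bs) m)%:E.
  rewrite /tail {headE tail0 tail}.
  elim: q m => [|q' IHq] m; first exact: IHbs.
  rewrite /= -(esum_psum_op _ _ IHq) => [|i|rs i]; last 2 first.
  - exact: invpow_ge0.
  - rewrite mulr_ge0 ?exprn_ge0//.
    elim: q' i {IHq} => [|q' IHq] i; first exact: zterm_ge0.
    by apply: psum_op_ge0 => // j; exact: invpow_ge0.
  by apply: eq_esum => rs _; rewrite /psum_op -mulr_sumr mulrCA.
have bij : set_bij ([set s | 0 < s]%N `*` all_indices (size bs))
    (all_indices (size ((p, q) :: bs))) (fun z => z.1 :: z.2).
  split.
  - move=> [s rs] /= [s0 [irs szrs]]; split=> /=; last by rewrite szrs.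
    by rewrite s0.
  - by move=> [s rs] [s' rs'] _ _ /= [-> ->].
  - move=> [|s rs] [//= /andP[s0 irs] [szrs]].
    by exists (s, rs).
rewrite (reindex_esum _ _ _ _ bij) -(@esum_esum _ _ _ _ (fun=> _) (fun s rs =>
  (x ^+ sumn (s :: rs) * zterm (block_index ((p, q) :: bs) (s :: rs)) n)%:E))//.
  case: n => [|n].
    rewrite [in RHS]/block_term/= psum_op0 esum1// => s _.
    by rewrite esum1// => rs _; rewrite headE psum_op0 mulr0.
  rewrite [in RHS]/block_term/= nest_nseq_cat [in RHS]/psum_op -/(block_term x bs).
  rewrite mulrC EFinM -esum_geometric_weight// -esumZl; last 2 first.
  - apply: sumr_ge0 => i _.
    rewrite -lee_fin -tailE esum_ge0// => rs _.
    by rewrite lee_fin mulr_ge0 ?exprn_ge0.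
  - by move=> s _; rewrite lee_fin mulr_ge0 ?exprn_ge0 ?invpow_ge0.
  apply: eq_esum => s _; rewrite -EFinM mulrC EFinM -sumEFin.
  under [in RHS]eq_bigr do rewrite -tailE.
  rewrite -esum_sum => [|rs i _ _]; last by rewrite lee_fin mulr_ge0 ?exprn_ge0.
  rewrite -esumZl; last 2 first.
  - by rewrite mulr_ge0 ?exprn_ge0 ?invpow_ge0.
  - move=> rs _; apply: sume_ge0 => i _.
    by rewrite lee_fin mulr_ge0 ?exprn_ge0.
  apply: eq_esum => rs _; rewrite headE sumEFin -EFinM -mulr_sumr exprD.
  by congr _%:E; rewrite /psum_op mulrACA.
by move=> s rs _ _; rewrite lee_fin mulr_ge0 ?exprn_ge0 ?zterm_ge0.
Qed.

Lemma finite_indices d w : finite_set (indices d w).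
Proof.
have fin : finite_set [set s : seq nat | size s = d /\ all (fun m => m < w.+1)%N s].
  elim: d => [|d IHd].
    apply: (sub_finite_set _ (finite_set1 [::])).
    by move=> s [/size0nil -> _].
  apply: (sub_finite_set _ (finite_image (fun z => z.1 :: z.2)
    (finite_setX (finite_II w.+1) IHd))).
  by move=> [|m s] [//= [szs] /andP[mw sw]]; exists (m, s).
apply: sub_finite_set fin => s [_ szs sms]; split=> //; apply/allP => m ms.
by rewrite ltnS -sms; elim: s ms {szs sms} => //= m' s IHs;
  rewrite inE => /orP[/eqP ->|/IHs/leq_trans -> //];
  rewrite ?leq_addr ?leq_addl.
Qed.

Definition mzv_sum bs (w : nat) : R :=
  (\sum_(rs \in indices (size bs) w) mzv R (block_index bs rs))%R.

Lemma tsum_block_index_fin b bs rs : all (fun c => 0 < c.1)%N (b :: bs) ->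
  is_index rs -> size rs = (size bs).+1 ->
  tsum (zterm (block_index (b :: bs) rs) : nat -> R) < +oo.
Proof.
case: rs => //= s rs /andP[b0 bs0] /andP[s0 irs] [szrs].
apply: tsum_zterm_fin; first by rewrite -addn1 leq_add.
rewrite /is_index all_cat all_nseq orbT/=.
elim: bs rs bs0 irs {szrs} => [|c bs IHbs] [|t rs]//=.
move=> /andP[c0 bs0] /andP[t0 irs].
by rewrite addn_gt0 c0/= all_cat all_nseq orbT/=; exact: IHbs.
Qed.

Lemma mzv_ge0 (k : seq nat) : (0 <= mzv R k)%R.
Proof.
rewrite mzvE fine_ge0// esum_ge0// => n _.
by rewrite lee_fin zterm_ge0.
Qed.

Lemma mzv_sum_ge0 bs w : (0 <= mzv_sum bs w)%R.
Proof. by apply: fsumr_ge0 => rs _; exact: mzv_ge0. Qed.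

(** The expansion [esum_block_index] is summed over n and its indices are grouped by weight. *)
Lemma tsum_block_term (x : R) b bs : (0 <= x <= 2^-1)%R ->
  all (fun c => 0 < c.1)%N (b :: bs) ->
  tsum (block_term x (b :: bs)) =
  \esum_(w in [set: nat]) (mzv_sum (b :: bs) w * x ^+ w)%:E.
Proof.
move=> xh bs0; have x0 : (0 <= x)%R by case/andP: xh.
rewrite /tsum; under eq_esum do rewrite -esum_block_index//.
rewrite esum_swap; last first.
  by move=> n rs; rewrite lee_fin mulr_ge0 ?exprn_ge0 ?zterm_ge0.
have -> : all_indices (size (b :: bs)) =
    \bigcup_(w in [set: nat]) indices (size (b :: bs)) w.
  apply/seteqP; split => [rs [irs szrs]|rs [w _ []]//].
  by exists (sumn rs).
rewrite esum_bigcupT; last 2 first.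
- by apply/trivIsetP => w w' _ _ ww'; apply/seteqP; split => // rs /= [];
    move=> [_ _ Ew] [_ _ Ew']; rewrite -Ew -Ew' eqxx in ww'.
- move=> rs; apply: esum_ge0 => n _.
  by rewrite lee_fin mulr_ge0 ?exprn_ge0 ?zterm_ge0.
apply: eq_esum => w _.
rewrite /mzv_sum mulr_fsuml -fsumEFin; last exact: finite_indices.
rewrite -esum_fset; last 2 first.
- exact: finite_indices.
- by move=> rs _; rewrite lee_fin mulr_ge0 ?mzv_ge0 ?exprn_ge0.
apply: eq_esum => rs [irs szrs <-].
under eq_esum do rewrite EFinM.
rewrite esumZl ?exprn_ge0//; last by move=> n _; rewrite lee_fin zterm_ge0.
rewrite mulrC EFinM; congr (_ * _).
rewrite mzvE fineK// ge0_fin_numE ?tsum_block_index_fin//.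
by apply: esum_ge0 => n _; rewrite lee_fin zterm_ge0.
Qed.

End GeneratingFunctions.

(** * Uniqueness of coefficients of nonnegative power series *)

Section PowerSeries.
Context {R : realType}.
Implicit Types p q : nat -> R.

(* For j > N, x^j <= (2 x)^(N+1) 2^-j, so that the tail of the right-hand series
   is O(x^(N+1)). *)
Lemma power_series_coef_le p q N : (forall j, 0 <= p j) -> (forall j, 0 <= q j) ->
  (forall x : R, 0 < x <= 2^-1 ->
    (\esum_(j in [set: nat]) (p j * x ^+ j)%:E <=
     \esum_(j in [set: nat]) (q j * x ^+ j)%:E)%E) ->
  (\esum_(j in [set: nat]) (q j * 2^-1 ^+ j)%:E < +oo)%E ->
  (forall j, (j < N)%N -> p j = q j) -> p N <= q N.
Proof.
move=> p0 q0 pq qfin pqN.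
pose M := fine (\esum_(j in [set: nat]) (q j * 2^-1 ^+ j)%:E)%E.
have ME : (\esum_(j in [set: nat]) (q j * 2^-1 ^+ j)%:E = M%:E)%E.
  rewrite fineK// ge0_fin_numE// esum_ge0// => j _.
  by rewrite lee_fin mulr_ge0 ?exprn_ge0.
have M0 : 0 <= M.
  rewrite fine_ge0// esum_ge0// => j _.
  by rewrite lee_fin mulr_ge0 ?exprn_ge0.
have bound x : 0 < x <= 2^-1 -> p N <= q N + x * (2 ^+ N.+1 * M).
  move=> /[dup] xh /andP[x0 xle].
  have xj j : 0 <= x ^+ j by rewrite exprn_ge0// ltW.
  have : (\sum_(j < N.+1) p j * x ^+ j <=
          \sum_(j < N.+1) q j * x ^+ j + (2 * x) ^+ N.+1 * M).
    rewrite -lee_fin EFinD (esum_nat_lt _ (F := fun j => p j * x ^+ j));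
      last by move=> j; rewrite mulr_ge0.
    apply: (@le_trans _ _ (\esum_(j in [set: nat]) (p j * x ^+ j)%:E)%E).
      apply: le_esum => j _; rewrite lee_fin ler_piMl ?mulr_ge0//.
      by case: (_ < _)%N.
    apply: le_trans (pq _ xh) _.
    rewrite EFinM -ME (esum_nat_lt _ (F := fun j => q j * x ^+ j));
      last by move=> j; rewrite mulr_ge0.
    have x2 : 0 <= 2 * x by lra.
    rewrite -esumZl ?exprn_ge0//; last first.
      by move=> j _; rewrite lee_fin mulr_ge0 ?exprn_ge0.
    rewrite -esumD; last 2 first.
    - by move=> j _; rewrite lee_fin !mulr_ge0.
    - by move=> j _; rewrite -EFinM lee_fin !mulr_ge0 ?exprn_ge0.
    apply: le_esum => j _; rewrite -EFinM -EFinD lee_fin.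
    have [jN|Nj] := ltnP j N.+1.
      by rewrite mul1r lerDl !mulr_ge0 ?exprn_ge0.
    rewrite mul0r add0r mulrCA ler_wpM2l//.
    have -> : x ^+ j = (2 * x) ^+ j * 2^-1 ^+ j.
      by rewrite -exprMn mulrAC divff ?mul1r.
    rewrite ler_wpM2r ?exprn_ge0// ler_wiXn2l//; lra.
  rewrite !big_ord_recr/= (eq_bigr (fun j : 'I_N => q j * x ^+ j)); last first.
    by move=> j _; rewrite pqN.
  rewrite -addrA lerD2l exprMn [in x ^+ N.+1]exprSr => le_pq.
  have xN : 0 < x ^+ N by rewrite exprn_gt0.
  rewrite -(ler_pM2r xN); apply: le_trans le_pq _.
  by rewrite le_eqVlt; apply/orP; left; apply/eqP; ring.
apply/ler_addgt0Pr => e e0.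
have C0 : 0 < 2 ^+ N.+1 * M + 1.
  by rewrite ltr_wpDl// mulr_ge0// exprn_ge0.
(* Makes the error x 2^(N+1) M at most e; the added 1 keeps the denominator positive when M = 0. *)
pose x := Num.min 2^-1 (e / (2 ^+ N.+1 * M + 1)).
have xh : 0 < x <= 2^-1.
  by rewrite lt_min invr_gt0 ltr0n/= divr_gt0//= ge_min lexx.
apply: le_trans (bound _ xh) _; rewrite lerD2l.
case/andP: xh => x0 _.
have xe : x <= e / (2 ^+ N.+1 * M + 1) by rewrite ge_min lexx orbT.
rewrite ler_pdivlMr// in xe; apply: le_trans xe.
by rewrite ler_pM2l// lerDl.
Qed.

Lemma power_series_coef_eq p q : (forall j, 0 <= p j) -> (forall j, 0 <= q j) ->
  (forall x : R, 0 < x <= 2^-1 ->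
    (\esum_(j in [set: nat]) (p j * x ^+ j)%:E =
     \esum_(j in [set: nat]) (q j * x ^+ j)%:E)%E) ->
  (\esum_(j in [set: nat]) (q j * 2^-1 ^+ j)%:E < +oo)%E ->
  forall N, p N = q N.
Proof.
move=> p0 q0 pq qfin N.
have pq_half := pq 2^-1; elim/ltn_ind: N => N IHN.
apply/eqP; rewrite eq_le; apply/andP; split.
  by apply: power_series_coef_le => // x xh; rewrite pq.
apply: power_series_coef_le => //.
- by move=> x xh; rewrite pq.
- by rewrite pq_half// lexx andbT; lra.
- by move=> j jN; rewrite IHN.
Qed.

End PowerSeries.

(** * Enumeration of the refinements *)

Section RefinementEnumeration.
Implicit Types (k l g : seq nat) (L : seq (seq nat)).

Lemma mem_refine_block L q l : (0 < q)%N ->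
  reflect (exists g l', [/\ is_index g, g != [::], sumn g = q, l' \in L
                          & l = g ++ l'])
          (l \in refine_block L q).
Proof.
case: q => // q _; rewrite /refine_block/=; apply: (iffP idP).
  elim: q l => [|q IHq] l /=.
    by move=> /mapP[l' l'L ->]; exists [:: 1%N], l'.
  rewrite mem_cat => /orP[] /mapP[m /IHq[g [l' [ig gn sg l'L ->]]] ->].
    case: g ig gn sg => // p g /= /andP[p0 ig] _ sg.
    by exists (p.+1 :: g), l'; split=> //=; rewrite addSn sg.
  by exists (1%N :: g), l'; split=> //=; rewrite sg.
move=> [g [l' [ig gn sg l'L ->]]].
elim: q g ig gn sg => [|q IHq] [|[//|p] g] //= ig _ sg.
  have -> : g = [::].
    by case: g ig sg => // -[//|m] g _ /=; rewrite addSn addnS.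
  have -> : p = 0%N by move: sg; rewrite addSn => -[] /eqP;
    rewrite addn_eq0 => /andP[/eqP].
  by rewrite map_f.
(* A head 1 was opened by the last step, a larger head was incremented by it. *)
rewrite mem_cat; case: p sg => [|p] sg; apply/orP; [right|left].
  apply: map_f; apply: IHq => //; last by move: sg; rewrite add1n => -[].
  by case: g sg {ig}.
rewrite -[p.+2 :: g ++ l']/(incr_head ((p.+1 :: g) ++ l')).
by apply: map_f; apply: IHq => //=; move: sg; rewrite !addSn => -[->].
Qed.

Lemma mem_refinements k l : is_index k ->
  reflect (is_index l /\ refines l k) (l \in refinements k).
Proof.
elim: k l => [|q k IHk] l /=.
  move=> _; rewrite inE; apply: (iffP eqP) => [->|].
    by split; [exact: isT|exists [::]; split].
  by move=> [_ [[|g gs] [_ <- //]]].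
move=> /andP[q0 ik]; apply: (iffP (mem_refine_block _ _ q0)).
  move=> [g [l' [ig gn sg /(IHk _ ik)[il' [gs [gsn fgs sgs]]] ->]]].
  split; first by rewrite /is_index all_cat; apply/andP.
  by exists (g :: gs); rewrite /= gn fgs sg sgs.
move=> [il [[|g gs] [//= /andP[gn gsn] fgs [sg sgs]]]].
move: il; rewrite -fgs /is_index all_cat => /andP[ig igs].
exists g, (flatten gs); split=> //; apply/(IHk _ ik); split=> //.
by exists gs.
Qed.

Lemma size_refines l k : refines l k -> (size k <= size l)%N.
Proof.
move=> [gs [gsn <- <-]]; rewrite size_map size_flatten /shape.
elim: gs gsn => //= g gs IHgs /andP[gn /IHgs].
by case: g gn => //= m g _ le; rewrite addSn ltnS (leq_trans le)// leq_addl.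
Qed.

(** The invariant that heads are positive separates the two outcomes of a step: an incremented head
    is at least 2, a new one is 1. *)
Lemma refinements_uniq k : uniq (refinements k).
Proof.
elim: k => //= q k; move: (refinements k) => L uL; rewrite /refine_block.
have : uniq (map (cons 1%N) L) && all (fun l => 0 < head 0 l)%N (map (cons 1%N) L).
  by rewrite map_inj_uniq ?uL => [|? ? []//]; apply/allP => _ /mapP[l _ ->].
elim: q.-1 (map _ L) => {L uL} [|j IHj] L /andP[uL L0]; first exact: uL.
rewrite iterSr; apply: IHj; apply/andP; split; last first.
  rewrite all_cat !all_map; apply/andP; split; last exact/allP.
  by apply: sub_all L0 => -[].
rewrite cat_uniq map_inj_in_uniq ?uL/=; last first.
  move=> [|p l] [|p' l'] /(allP L0) //= _ /(allP L0) //= _ [-> ->].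
  by [].
rewrite map_inj_uniq ?uL ?andbT => [|? ? []//].
apply/hasPn => _ /mapP[l _ ->]; apply/mapP => -[[|[|p] l'] /(allP L0)] //=.
Qed.

End RefinementEnumeration.

(** * Duality and comparison of the generating functions *)

Section Main.
Context {R : realType}.
Implicit Types (k l rs : seq nat).

Lemma block_index_nil k rs :
  block_index [seq (p, 0)%N | p <- k] rs = index_add k rs.
Proof.
by rewrite /block_index /index_add; elim: k rs => [|p k IHk] [|s rs] //=;
  rewrite IHk.
Qed.

(** The right-hand side is the dual index of [tsum_pad_dual]; its blocks r_i + 1, 1, ..., 1 have k_i
    - 1 ones. *)
Lemma block_index_ones k rs : size k = size rs ->
  block_index [seq (1, q.-1)%N | q <- rev k] (rev rs) =
  flatten (rev [seq p.2.+1 :: nseq p.1.-1 1%N | p <- zip k rs]).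
Proof.
move=> szk; rewrite /block_index [in zip _ _]map_rev -rev_zip ?size_map//.
rewrite map_rev; congr (flatten (rev _)).
by elim: k rs szk => [|p k IHk] [|s rs] //= [/IHk ->].
Qed.

Lemma mzv_pad_sum k w : is_index k ->
  \sum_(rs \in indices (size k) w) mzv R (index_pad k rs) =
  mzv_sum [seq (1, q.-1)%N | q <- rev k] w.
Proof.
move=> ik; rewrite /mzv_sum size_map size_rev.
have bij : set_bij (indices (size k) w) (indices (size k) w) rev.
  have revI rs : indices (size k) w rs -> indices (size k) w (rev rs).
    by move=> [irs szrs srs]; split;
      rewrite ?size_rev ?sumn_rev// /is_index all_rev.
  split=> [rs /revI //|? ? _ _ /(can_inj revK)//|rs /revI rsI].
  by exists (rev rs) => //; rewrite revK.
rewrite [RHS](reindex_fsbig _ _ _ _ bij); apply: eq_fsbigr => rs.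
rewrite inE => -[irs szrs _].
by rewrite !mzvE tsum_pad_dual// block_index_ones.
Qed.

Lemma sign_split (I : eqType) (s : seq I) (e : I -> nat) (f : I -> R) :
  \sum_(i <- s) (-1) ^+ e i * f i =
  \sum_(i <- s | ~~ odd (e i)) f i - \sum_(i <- s | odd (e i)) f i.
Proof.
rewrite (bigID (fun i => odd (e i)))/= addrC -sumrN; congr (_ + _);
  apply: eq_bigr => i; rewrite -signr_odd.
  by move=> /negPf ->; rewrite mul1r.
by move=> ->; rewrite mulN1r.
Qed.

Lemma mzv_sum_refinements k w : is_index k -> (0 < size k)%N ->
  mzv_sum [seq (1, q.-1)%N | q <- rev k] w =
  \sum_(l <- refinements k)
    (-1) ^+ (size k + size l) * mzv_sum [seq (p, 0)%N | p <- l] w :> R.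
Proof.
move=> ik k0.
pose a j : R := mzv_sum [seq (1, q.-1)%N | q <- rev k] j.
pose b l j : R := mzv_sum [seq (p, 0)%N | p <- l] j.
have a0 j : 0 <= a j by exact: mzv_sum_ge0.
have b0 l j : 0 <= b l j by exact: mzv_sum_ge0.
pose e l := odd (size k + size l).
pose As x := (\esum_(j in [set: nat]) (a j * x ^+ j)%:E)%E.
pose Bs l x := (\esum_(j in [set: nat]) (b l j * x ^+ j)%:E)%E.
have As_block (x : R) : 0 <= x <= 2^-1 ->
    As x = tsum (block_term x [seq (1, q.-1)%N | q <- rev k]) /\ (As x < +oo)%E.
  move=> xh; rewrite /As /a.
  have : (0 < size (rev k))%N by rewrite size_rev.
  case: (rev k) => // q ks _ /=.
  have bs0 : all (fun c : nat * nat => 0 < c.1)%N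
      ((1, q.-1)%N :: [seq (1, q.-1)%N | q <- ks]).
    by rewrite /= all_map; apply/allP.
  by rewrite -tsum_block_term//; split=> //; exact: tsum_block_fin.
have Bs_bterm (x : R) l : 0 <= x <= 2^-1 -> l \in refinements k ->
    Bs l x = tsum (bterm x l) /\ (Bs l x < +oo)%E.
  move=> xh /(mem_refinements _ ik)[il /size_refines].
  rewrite /Bs /b bterm_block; case: l il => [_|p l il _ /=].
    by rewrite leqn0 => /eqP k00; rewrite k00 in k0.
  have bs0 : all (fun c : nat * nat => 0 < c.1)%N
      ((p, 0)%N :: [seq (p, 0)%N | p <- l]).
    by move: il => /=/andP[p0 il]; rewrite /= p0/= all_map.
  by rewrite -tsum_block_term//; split=> //; exact: tsum_block_fin.
(* Uniqueness of coefficients is available for nonnegative ones, so the terms with a minus sign are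
   moved to the other side. *)
pose P j := a j + \sum_(l <- refinements k | e l) b l j.
pose Q j := \sum_(l <- refinements k | ~~ e l) b l j.
have P0 j : 0 <= P j by rewrite addr_ge0// sumr_ge0.
have Q0 j : 0 <= Q j by rewrite sumr_ge0.
have BsumE (d : pred (seq nat)) (x : R) : 0 <= x ->
    (\esum_(j in [set: nat])
       ((\sum_(l <- refinements k | d l) b l j) * x ^+ j)%:E =
     \sum_(l <- refinements k | d l) Bs l x)%E.
  move=> x0; rewrite /Bs -esum_sum; last first.
    by move=> j l _ _; rewrite lee_fin mulr_ge0 ?exprn_ge0.
  by apply: eq_esum => j _; rewrite sumEFin mulr_suml.
have Bs_fin (x : R) (d : pred (seq nat)) : 0 <= x <= 2^-1 ->
    (\sum_(l <- refinements k | d l) Bs l x =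
     (\sum_(l <- refinements k | d l) fine (Bs l x))%:E)%E.
  move=> xh; rewrite -sumEFin big_seq_cond [RHS]big_seq_cond.
  apply: eq_bigr => l /andP[lL _]; rewrite fineK// ge0_fin_numE.
    by case: (Bs_bterm _ _ xh lL).
  apply: esum_ge0 => j _; case/andP: xh => x0 _.
  by rewrite lee_fin mulr_ge0 ?exprn_ge0.
have PQ j : P j = Q j.
  apply: (power_series_coef_eq P0 Q0) => [x /andP[/ltW x0 xh]|]; last first.
    have h : 0 <= (2^-1 : R) <= 2^-1 by rewrite lexx invr_ge0 ler0n.
    by rewrite BsumE ?invr_ge0// Bs_fin// ltry.
  have xh' : 0 <= x <= 2^-1 by rewrite x0.
  under eq_esum do rewrite /P mulrDl EFinD.
  rewrite esumD => [|i _|i _]; last 2 first.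
  - by rewrite lee_fin mulr_ge0 ?exprn_ge0.
  - by rewrite lee_fin mulr_ge0 ?sumr_ge0 ?exprn_ge0.
  rewrite !BsumE// !Bs_fin// -/(As x).
  have [AsE As_fin] := As_block _ xh'.
  have As0 : (0 <= As x)%E.
    by apply: esum_ge0 => i _; rewrite lee_fin mulr_ge0 ?exprn_ge0.
  rewrite -(@fineK _ (As x)) ?ge0_fin_numE// AsE fine_tsum_refinements//.
  rewrite -EFinD; congr _%:E.
  rewrite (sign_split _ (fun l => size k + size l)%N).
  have tB (c : pred (seq nat)) :
      \sum_(l <- refinements k | c l) fine (tsum (bterm x l)) =
      \sum_(l <- refinements k | c l) fine (Bs l x).
    rewrite big_seq_cond [RHS]big_seq_cond; apply: eq_bigr => l /andP[lL _].
    by case: (Bs_bterm _ _ xh' lL) => ->.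
  by rewrite !tB subrK.
move: (PQ w); rewrite /P /Q (sign_split _ (fun l => size k + size l)%N).
by move=> <-; rewrite addrK.
Qed.

End Main.

Theorem theorem1p2 (R : realType) (d : nat) (hd : (1 <= d)%N)
    (k : d.-tuple nat) (hk : is_index k) (r : nat) (hr : (d <= r)%N) :
  \sum_(rs \in indices d r) mzv R (index_pad k rs) =
  \sum_(k' \in [set k' | [/\ is_index k', refines k' k & (size k' <= r)%N]])
    \sum_(rs \in indices (size k') r)
      (-1) ^+ (size k' - d) * mzv R (index_add k' rs).
Proof.
have szk : size k = d by rewrite size_tuple.
rewrite -{1}szk mzv_pad_sum// mzv_sum_refinements ?szk//.
rewrite (fsbig_fwiden (refinements k)) ?refinements_uniq//; last 2 first.
- by move=> l [il lk _] /=; apply/(mem_refinements _ hk).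
(* An index of weight r has depth at most r, so deeper refinements have an empty inner sum. *)
- move=> l [/= /(mem_refinements _ hk)[il lk] lP].
  rewrite fsbig1// => rs [irs szrs srs]; exfalso; apply: lP; split=> //.
  rewrite -srs -szrs; elim: rs irs {szrs srs} => //= m rs IHrs /andP[m0 /IHrs].
  by rewrite -add1n; exact: leq_add.
apply: eq_big_seq => l /(mem_refinements _ hk)[_ /size_refines szl].
rewrite /mzv_sum size_map mulr_fsumr; apply: eq_fsbigr => rs _.
rewrite block_index_nil; congr (_ * _).
(* A refinement has depth at least d, so the truncated difference is exact and has the parity of the
   sum. *)
by rewrite -signr_odd oddD -[RHS]signr_odd oddB -?szk// addbC.
Qed.
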